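(* For every integer $g\ge 2$ let $x_g$ denote the unique root in $[0,1]$ of $f(x)=-x^{g-1}-x+1$. For every integer $g\ge 2$ and every $\varepsilon>0$ there exists an algorithm for the graphic matroid secretary problem which, on every weighted loopless multigraph $G$ of girth at least $g$, satisfies $\mathbb{E}[ALG]\ge \left(\frac{x_g}{e}-\varepsilon\right)OPT(G)$. In particular (since $x_g\to 1$ as $g\to\infty$), on graphs of girth at least $g$ one can achieve competitive ratio $e\,(1+o_g(1))$.
   Context: Graphic matroid secretary problem: the input is a finite undirected multigraph $G=(V,E)$ without loops, with $|E|=m$ and edge weights $w:E\to\mathbb{R}_{\ge 0}$; the algorithm knows $V$ and $m$ in advance. Edges arrive one at a time in a uniformly random order; upon arrival the algorithm learns the edge's endpoints and weight and must irrevocably accept or reject it, keeping the accepted set acyclic. The algorithm may be randomized. $ALG$ is the total accepted weight and $OPT(G)$ is the maximum weight of an acyclic edge set. The girth of a graph is the length of its shortest cycle (a pair of parallel edges is a cycle of length 2; a forest has infinite girth). An algorithm is $\alpha$-competitive on a family if $\alpha\,\mathbb{E}[ALG]\ge OPT(G)$ for all $G$ in the family. *)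

(* Defs.v *)
From HB Require Import structures.
From mathcomp Require Import all_boot all_order all_algebra all_fingroup.
From mathcomp Require Import all_classical all_reals all_analysis.
Set Implicit Arguments. Unset Strict Implicit. Unset Printing Implicit Defensive.
Import Order.TTheory GRing.Theory Num.Theory.
Local Open Scope ring_scope.

Definition joins {V : eqType} (p : V * V) (a b : V) : bool :=
  (p == (a, b)) || (p == (b, a)).

(** A cycle of length [k] (k >= 2) using edges (indices of type [I], with
    endpoints [ends]) satisfying [S]: distinct edges e_0..e_{k-1} and distinct
    vertices v_0..v_{k-1} such that e_i joins v_i and v_{(i+1) mod k}.
    Two parallel edges form a cycle of length 2. *)
Definition has_cycle_of_length {I : Type} {V : eqType}
    (S : I -> Prop) (ends : I -> V * V) (k : nat) : Prop :=
  (2 <= k)%N /\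
  exists (es : nat -> I) (vs : nat -> V),
    [/\ (forall i j, (i < k)%N -> (j < k)%N -> es i = es j -> i = j),
        (forall i j, (i < k)%N -> (j < k)%N -> vs i = vs j -> i = j) &
        (forall i, (i < k)%N ->
           S (es i) /\ joins (ends (es i)) (vs i) (vs (i.+1 %% k)%N))].

Definition acyclic {I : Type} {V : eqType} (S : I -> Prop) (ends : I -> V * V)
  : Prop := forall k, ~ has_cycle_of_length S ends k.

Definition loopless {V : eqType} (m : nat) (ends : 'I_m -> V * V) : Prop :=
  forall e, (ends e).1 != (ends e).2.

Definition girth_ge {V : eqType} (m : nat) (ends : 'I_m -> V * V) (g : nat)
  : Prop := forall k, (k < g)%N -> ~ has_cycle_of_length (fun _ => True) ends k.

Definition OPT {R : realType} {V : finType} (m : nat)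
    (ends : 'I_m -> V * V) (w : 'I_m -> R) : R :=
  \big[Num.max/0]_(S : {set 'I_m} | `[< acyclic (fun e => e \in S) ends >])
     \sum_(e in S) w e.

(** An online (randomized, behavioural) algorithm: given the vertex set [V],
    the number of edges [m], the history (endpoints, weight, own decision of
    every previously arrived edge, in arrival order), and the endpoints and
    weight of the current edge, it returns the probability of accepting it. *)
Definition online_alg (R : realType) : Type :=
  forall (V : finType), nat -> seq ((V * V) * R * bool) -> V * V -> R -> R.

Definition accepted_ends {R : Type} {V : Type} (h : seq ((V * V) * R * bool))
  : seq (V * V) := [seq x.1.1 | x <- h & x.2].

Definition valid_alg {R : realType} (alg : online_alg R) : Prop :=
  forall (V : finType) (m : nat) (h : seq ((V * V) * R * bool)) (uv : V * V)
         (wt : R),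
    (0 <= alg V m h uv wt <= 1) /\
    (~ acyclic (fun _ => True) (tnth (in_tuple (rcons (accepted_ends h) uv)))
       -> alg V m h uv wt = 0).

Fixpoint exp_gain {R : realType} {V : Type}
    (A : seq ((V * V) * R * bool) -> V * V -> R -> R)
    (h : seq ((V * V) * R * bool)) (a : seq ((V * V) * R)) : R :=
  match a with
  | [::] => 0
  | x :: a' =>
      let p := A h x.1 x.2 in
      p * (x.2 + exp_gain A (rcons h (x.1, x.2, true)) a')
      + (1 - p) * exp_gain A (rcons h (x.1, x.2, false)) a'
  end.

Definition expected_alg {R : realType} (alg : online_alg R) {V : finType}
    (m : nat) (ends : 'I_m -> V * V) (w : 'I_m -> R) : R :=
  (#|{perm 'I_m}|%:R)^-1 *
  \sum_(s : {perm 'I_m})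
     exp_gain (alg V m) [::] [seq (ends (s t), w (s t)) | t <- enum 'I_m].

(* Main.v *)
Require Import Defs.
From HB Require Import structures.
From mathcomp Require Import all_boot all_order all_algebra all_fingroup.
From mathcomp Require Import all_classical all_reals all_analysis.
From mathcomp Require Import zify ring lra.
Set Implicit Arguments. Unset Strict Implicit. Unset Printing Implicit Defensive.
Import Order.TTheory GRing.Theory Num.Theory.
Local Open Scope ring_scope.

(** With the arrival order fixed, after a sample of [tau] edges each arriving edge
    that belongs to the current offline optimum is owned by one of its endpoints,
    different edges of that optimum having different owners; it becomes a candidate
    if its owner owned no earlier such edge. Reading the arrivals backwards, the
    [s]-th one ([s] counted from 0) hits a given owner with probability at most
    [1 / (s + 1)], so, as in the secretary problem, the candidates have expected
    weight at least [OPT / e].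
    Candidates have distinct owners, so two cycles of candidates that share an edge
    coincide. Flip a coin of bias [x] for every position. A candidate that closes
    no cycle of candidates is accepted on heads. If it closes one, the at least
    [g - 1] other edges of that cycle closed no cycle themselves and were accepted
    with probability at most [x ^ (g - 1) = 1 - x]; it is accepted unless they all
    were, hence with probability at least [x]. *)

(** * Cycles whose edges own distinct endpoints *)

Lemma joinsC {V : eqType} (p : V * V) (a b : V) : joins p a b = joins p b a.
Proof. by rewrite /joins orbC. Qed.

Lemma joins_inj {V : eqType} (p : V * V) (a b b' : V) :
  joins p a b -> joins p a b' -> b = b'.
Proof.
by case/orP=> /eqP-> /orP[]/eqP[] => [//|-> ->|-> ->|->].
Qed.

Definition tl {V : eqType} (p : V * V) (b : bool) : V := if b then p.2 else p.1.

Lemma tl_joins {V : eqType} (p : V * V) (b : bool) (u v : V) :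
  joins p u v -> (tl p b == u) || (tl p b == v).
Proof.
by case/orP=> /eqP->; case: b; rewrite /tl /= eqxx ?orbT.
Qed.

Definition cycle_on {I V : eqType} (ends : I -> V * V) (k : nat)
    (es : nat -> I) (vs : nat -> V) : Prop :=
  forall i, (i < k)%N -> joins (ends (es i)) (vs i) (vs (i.+1 %% k)%N).

Definition edges_of {I : eqType} (Q : pred I) (k : nat) (es : nat -> I) : Prop :=
  forall e, e \in Q <-> exists2 i, (i < k)%N & es i = e.

Definition is_cycle {I V : eqType} (ends : I -> V * V) (Q : pred I) : Prop :=
  exists k es vs,
    [/\ (2 <= k)%N,
        (forall i j, (i < k)%N -> (j < k)%N -> es i = es j -> i = j),
        (forall i j, (i < k)%N -> (j < k)%N -> vs i = vs j -> i = j),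
        cycle_on ends k es vs
      & edges_of Q k es].

(* When every edge owns a private endpoint, the owners of the edges of a cycle
   force a consistent direction of travel. *)
Lemma cycle_directed {I V : eqType} (ends : I -> V * V) (Q : pred I)
    (o : I -> bool) :
  {in Q &, injective (fun e => tl (ends e) (o e))} ->
  is_cycle ends Q ->
  exists k es vs,
    [/\ (0 < k)%N, cycle_on ends k es vs, edges_of Q k es
      & forall i, (i < k)%N -> tl (ends (es i)) (o (es i)) = vs i].
Proof.
move=> injQ [k [es [vs [k2 es_inj vs_inj cyc Qes]]]].
have k0 : (0 < k)%N by exact: leq_trans k2.
have esQ i : (i < k)%N -> es i \in Q by move=> ik; apply/Qes; exists i.
have [fwd|] := pselect (forall i, (i < k)%N -> tl (ends (es i)) (o (es i)) = vs i).
  by exists k, es, vs.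
move=> /existsNP[i0] /not_implyP[i0k /eqP ne0].
have tlP i : (i < k)%N -> tl (ends (es i)) (o (es i)) = vs i \/
    tl (ends (es i)) (o (es i)) = vs (i.+1 %% k)%N.
  by move=> ik; case/orP: (tl_joins (o (es i)) (cyc i ik)) => /eqP; [left|right].
(* Being owned by the head passes from an edge to the next one: owned by its tail, the next edge
   would share its owner with its predecessor. *)
have bwd n : tl (ends (es ((i0 + n) %% k)%N)) (o (es ((i0 + n) %% k)%N))
             = vs ((i0 + n).+1 %% k)%N.
  elim: n => [|n IH].
    by rewrite addn0 modn_small //; case: (tlP i0 i0k) => // E; rewrite E eqxx in ne0.
  rewrite addnS; set j := (i0 + n)%N in IH *.
  have jk : (j %% k < k)%N by rewrite ltn_mod.
  have j1k : (j.+1 %% k < k)%N by rewrite ltn_mod.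
  have e1 : ((j.+1 %% k).+1 %% k = j.+2 %% k)%N by rewrite -addn1 modnDml addn1.
  case: (tlP _ j1k); last by rewrite e1.
  rewrite -IH => /(injQ _ _ (esQ _ j1k) (esQ _ jk)) /(es_inj _ _ j1k jk).
  move/eqP; rewrite -addn1 -[X in _ == (X %% _)%N]addn0 eqn_modDl mod0n modn_small //.
have bwd' i : (i < k)%N -> tl (ends (es i)) (o (es i)) = vs (i.+1 %% k)%N.
  move=> ik; have := bwd (i + k - i0)%N.
  have -> : (i0 + (i + k - i0) = i + k)%N by lia.
  by rewrite -addSn !modnDr (modn_small ik).
(* All edges point backwards, so the cycle is listed in reverse: edge [k.-1 - i] is owned by vertex
   [(k - i) %% k]. *)
exists k, (fun i => es (k.-1 - i)%N), (fun i => vs ((k - i) %% k)%N); split=> //.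
- move=> i ik; rewrite joinsC.
  have -> : ((k - i) %% k = (k.-1 - i).+1 %% k)%N by congr (_ %% _)%N; lia.
  have -> : ((k - i.+1 %% k) %% k = k.-1 - i)%N.
    have [ik'|ik'] := ltnP i.+1 k; first by rewrite (modn_small ik') modn_small; lia.
    have -> : (i.+1 = k)%N by lia.
    by rewrite modnn subn0 modnn; lia.
  by apply: cyc; lia.
- move=> e; rewrite Qes; split=> -[i ik <-].
    by exists (k.-1 - i)%N; [lia|congr es; lia].
  by exists (k.-1 - i)%N => //; lia.
- move=> i ik /=; rewrite bwd'; last by lia.
  by congr vs; congr (_ %% _)%N; lia.
Qed.

(** In a directed cycle each edge determines the next: it leads from its owner to its other end,
    where only one edge of [S] is owned. From the common edge [e] on, both cycles therefore run
    together. *)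
Lemma cycle_sub {I V : eqType} (ends : I -> V * V) (Q Q' S : pred I)
    (o : I -> bool) (e : I) :
  {in S &, injective (fun e => tl (ends e) (o e))} ->
  {subset Q <= S} -> {subset Q' <= S} ->
  is_cycle ends Q -> is_cycle ends Q' -> e \in Q -> e \in Q' ->
  {subset Q <= Q'}.
Proof.
move=> injS QS Q'S cQ cQ' eQ eQ'.
have [k [es [vs [k0 cyc Qes tvs]]]] :=
  @cycle_directed I V ends Q o (sub_in2 QS injS) cQ.
have [k' [es' [vs' [k'0 cyc' Qes' tvs']]]] :=
  @cycle_directed I V ends Q' o (sub_in2 Q'S injS) cQ'.
have step i : (i < k)%N -> es i \in Q' -> es (i.+1 %% k)%N \in Q'.
  move=> ik /Qes'[j jk E].
  have vE : vs i = vs' j by rewrite -tvs // -tvs' // E.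
  have jk1 : (j.+1 %% k' < k')%N by rewrite ltn_mod.
  have ik1 : (i.+1 %% k < k)%N by rewrite ltn_mod.
  have v1E : vs (i.+1 %% k)%N = vs' (j.+1 %% k')%N.
    by apply: joins_inj (cyc i ik) _; rewrite vE -E; exact: cyc'.
  have in1 : es (i.+1 %% k)%N \in Q by apply/Qes; exists (i.+1 %% k)%N.
  have in2 : es' (j.+1 %% k')%N \in Q' by apply/Qes'; exists (j.+1 %% k')%N.
  rewrite (injS _ (es' (j.+1 %% k')%N) (QS _ in1) (Q'S _ in2)) //.
  by rewrite tvs // tvs'.
have /Qes[i0 i0k E0] := eQ.
have steps n : es ((i0 + n) %% k)%N \in Q'.
  elim: n => [|n IH]; first by rewrite addn0 modn_small // E0.
  have := step _ _ IH; rewrite ltn_mod => /(_ k0).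
  by rewrite -addn1 modnDml addn1 addnS.
move=> f /Qes[i ik <-].
have := steps (i + k - i0)%N.
have -> : (i0 + (i + k - i0) = i + k)%N by lia.
by rewrite modnDr modn_small.
Qed.

Lemma has_cycle_map {I J : Type} {V : eqType} (f : I -> J) (S : I -> Prop)
    (S' : J -> Prop) (ends : I -> V * V) (ends' : J -> V * V) (k : nat) :
  injective f -> (forall i, S i -> S' (f i)) -> (forall i, ends i = ends' (f i)) ->
  has_cycle_of_length S ends k -> has_cycle_of_length S' ends' k.
Proof.
move=> f_inj SS' eE [k2 [es [vs [es_inj vs_inj H]]]].
split=> //; exists (f \o es), vs; split=> // [i j ik jk /f_inj|i ik].
  exact: es_inj.
by have [Si J1] := H i ik; split; [exact: SS'|rewrite /= -eE].
Qed.

(** Edge sets, unlike the sequences in the definition of a cycle, can be compared, counted and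
    picked from a finite type. *)
Lemma is_cycleP {I : finType} {V : eqType} (ends : I -> V * V) (S : I -> Prop)
    (k : nat) :
  has_cycle_of_length S ends k <->
  exists Q : {set I}, [/\ is_cycle ends (mem Q), #|Q| = k & forall e, e \in Q -> S e].
Proof.
have card_img (es : nat -> I) :
    (forall i j, (i < k)%N -> (j < k)%N -> es i = es j -> i = j) ->
    #|[set es i | i : 'I_k]| = k.
  move=> es_inj; rewrite card_imset ?card_ord // => i j E.
  by apply: val_inj; exact: (es_inj _ _ (ltn_ord i) (ltn_ord j) E).
split=> [[k2 [es [vs [es_inj vs_inj H]]]]
        |[Q [[k' [es [vs [k2 es_inj vs_inj cyc Qes]]]] cQ QS]]].
  exists [set es i | i : 'I_k]; split; last 2 first.
  - by apply: card_img; exact: es_inj.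
  - by move=> e /imsetP[i _ ->]; case: (H i (ltn_ord i)).
  exists k, es, vs; split=> //; first by move=> i ik; case: (H i ik).
  move=> e; rewrite inE; split=> [/imsetP[i _ ->]|[i ik <-]].
    by exists i => //; exact: ltn_ord.
  by apply/imsetP; exists (Ordinal ik).
have kE : k' = k.
  have es_inj' : injective (fun i : 'I_k' => es i).
    by move=> i j E; apply: val_inj; exact: (es_inj _ _ (ltn_ord i) (ltn_ord j) E).
  rewrite -cQ -(card_ord k') -(card_imset _ es_inj').
  apply: eq_card => e; apply/imsetP/idP => [[i _ ->]|/Qes[i ik <-]].
    by apply/Qes; exists i.
  by exists (Ordinal ik).
subst k'; split=> //; exists es, vs; split=> // i ik; split; last exact: cyc.
by apply: QS; apply/Qes; exists i.
Qed.

(** * Forests and their orientations *)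

(** Among finitely many vertices the walk must return to one; the stretch that ends at the first
    return is a cycle, since no edge is taken twice in a row. *)
Lemma cycle_of_walk {I : eqType} {V : finType} (ends : I -> V * V)
    (S : I -> Prop) (es : nat -> I) (vs : nat -> V) :
  (forall e, S e -> (ends e).1 != (ends e).2) ->
  (forall n, S (es n)) ->
  (forall n, joins (ends (es n)) (vs n) (vs n.+1)) ->
  (forall n, es n.+1 != es n) ->
  exists k, has_cycle_of_length S ends k.
Proof.
move=> nl Ses J nb.
have rep : exists j, [exists i : 'I_j, vs i == vs j].
  have /injectivePn[i [j ij E]] : ~~ injectiveb (fun i : 'I_#|V|.+1 => vs i).
    by apply/negP => /injectiveP/leq_card; rewrite card_ord ltnn.
  have [lt|gt|eq] := ltngtP i j.
  - by exists j; apply/existsP; exists (Ordinal lt); rewrite /= E.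
  - by exists i; apply/existsP; exists (Ordinal gt); rewrite /= E.
  - by move/eqP: ij; case; exact: val_inj.
(* [j] is the first time an earlier vertex comes back, so the vertices before [j] are distinct. *)
case: (ex_minnP rep) => j /existsP[[i ij] /= /eqP vij] jmin.
have vinj a b : (a < b)%N -> (b < j)%N -> vs a <> vs b.
  move=> ab bj E; suff : (j <= b)%N by lia.
  by apply: jmin; apply/existsP; exists (Ordinal ab); rewrite /= E.
have vne n : vs n != vs n.+1.
  have := nl _ (Ses n); have := J n.
  by rewrite /joins => /orP[]/eqP -> //=; rewrite eq_sym.
(* Consecutive edges differ by assumption. For other equal edges the two ends agree, and
   distinctness before [j] forces [vs a = vs a.+1], a loop. *)
have einj a b : (i <= a)%N -> (a < b)%N -> (b < j)%N -> es a <> es b.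
  move=> ia ab bj E.
  have [ab1|ab1] := eqVneq a.+1 b; first by have := nb a; rewrite ab1 E eqxx.
  have Ja := J a; have Jb := J b; rewrite E in Ja.
  have va : vs a = vs b \/ vs a = vs b.+1.
    by case/orP: Ja Jb => /eqP -> /orP[]/eqP[]; auto.
  have va1 : vs a.+1 = vs b \/ vs a.+1 = vs b.+1.
    by case/orP: Ja Jb => /eqP -> /orP[]/eqP[]; auto.
  case: va1; first by apply: vinj; lia.
  case: va; first by move=> E'; case: (vinj a b ab bj).
  by move=> <- /eqP; rewrite eq_sym (negPf (vne a)).
have ij2 : (i.+1 < j)%N.
  rewrite ltn_neqAle ij andbT; apply/negP => /eqP E.
  by have := vne i; rewrite E vij eqxx.
exists (j - i)%N; split; first by lia.
exists (fun n => es (i + n)%N), (fun n => vs (i + n)%N); split.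
- move=> a b ak bk E; have [lt|gt|//] := ltngtP a b.
    by case: (einj (i + a)%N (i + b)%N); [lia|lia|lia|].
  by case: (einj (i + b)%N (i + a)%N); [lia|lia|lia|].
- move=> a b ak bk E; have [lt|gt|//] := ltngtP a b.
    by case: (vinj (i + a)%N (i + b)%N); [lia|lia|].
  by case: (vinj (i + b)%N (i + a)%N); [lia|lia|].
- move=> a ak; split=> //; have [lt|ge] := ltnP a.+1 (j - i)%N.
    by rewrite modn_small // addnS; exact: J.
  have -> : a.+1 = (j - i)%N by lia.
  rewrite modnn addn0 vij.
  by have := J (i + a)%N; rewrite (_ : (i + a).+1 = j); last lia.
Qed.

(** If every end of every edge of [S] met another edge of [S], one could walk forever without
    turning back, and so close a cycle. *)
Lemma acyclic_leaf {I V : finType} (ends : I -> V * V) (S : {set I}) (e0 : I) :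
  (forall e, (ends e).1 != (ends e).2) ->
  acyclic (fun e => e \in S) ends -> e0 \in S ->
  exists e b, e \in S /\ forall f b', f \in S -> f != e ->
    tl (ends f) b' <> tl (ends e) b.
Proof.
move=> nl acS e0S; apply: contrapT => noleaf.
(* A state is an edge with the bit of the end that the walk heads for; the next edge is entered at
   its end [~~ q.2]. *)
have step (p : I * bool) : exists q : I * bool, p.1 \in S ->
    [/\ q.1 \in S, q.1 != p.1 & tl (ends q.1) (~~ q.2) = tl (ends p.1) p.2].
  have [pS|] := boolP (p.1 \in S); last by exists p.
  apply: contrapT => nstep; apply: noleaf; exists p.1, p.2; split=> // f b' fS fp E.
  by apply: nstep; exists (f, ~~ b'); split=> //=; rewrite negbK.
have [nxt nxtP] := choice step.
pose p n := iter n nxt (e0, false).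
have pS n : (p n).1 \in S.
  by elim: n => //= n IH; case: (nxtP _ IH).
have [] := @cycle_of_walk I V ends (fun e => e \in S) (fun n => (p n).1)
  (fun n => tl (ends (p n).1) (~~ (p n).2)).
- by [].
- exact: pS.
- move=> n /=; have [_ _ ->] := nxtP _ (pS n).
  rewrite /joins /tl; case: (p n) => e b /=; case: (ends e) => u v.
  by case: b; rewrite /= eqxx ?orbT.
- by move=> n; have [] := nxtP _ (pS n).
- by move=> k; exact: acS.
Qed.

(** Peel off leaves: the removed edge owns its leaf vertex, which no remaining edge touches. *)
Lemma acyclic_orientation {I V : finType} (ends : I -> V * V) (S : {set I}) :
  (forall e, (ends e).1 != (ends e).2) ->
  acyclic (fun e => e \in S) ends ->
  exists o : I -> bool, {in S &, injective (fun e => tl (ends e) (o e))}.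
Proof.
move=> nl; move: {2}#|S| (erefl #|S|) => n.
elim: n S => [|n IH] S cS acS.
  by exists (fun=> false) => e f; rewrite (cards0_eq cS) inE.
have [e0 e0S] : exists e, e \in S by apply/card_gt0P; rewrite cS.
have [e [b [eS leaf]]] := acyclic_leaf nl acS e0S.
have [||o oinj] := IH (S :\ e).
- by have := cardsD1 e S; rewrite eS cS => -[].
- move=> k /(has_cycle_map (f := id) (S' := fun e => e \in S) (ends' := ends)) H.
  by apply: (acS k); apply: H => // f; rewrite !inE => /andP[].
exists (fun f => if f == e then b else o f) => f f' fS f'S.
have [->|ne] := eqVneq f e; have [->|ne'] := eqVneq f' e => //.
- by move=> E; case: (leaf f' (o f') f'S ne').
- by move=> E; case: (leaf f (o f) fS ne).
- by apply: oinj; rewrite !inE ?ne ?ne'.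
Qed.

(** * Averaging algorithms by Bayes' rule *)

(** The hypotheses say that [W j h] evolves like a prior times the likelihood of the decisions in
    [h] under [A j]. Accepting with the posterior mean probability then earns the posterior mean
    gain. *)
Lemma mixture_exp_gain {R : realType} {V J : finType}
    (A : J -> seq ((V * V) * R * bool) -> V * V -> R -> R)
    (W : J -> seq ((V * V) * R * bool) -> R) :
  (forall j h, 0 <= W j h) ->
  (forall j h uv wt, W j (rcons h (uv, wt, true)) = W j h * A j h uv wt) ->
  (forall j h uv wt, W j (rcons h (uv, wt, false)) = W j h * (1 - A j h uv wt)) ->
  forall a h,
  (\sum_j W j h) * exp_gain (fun h uv wt =>
      (\sum_j W j h * A j h uv wt) / (\sum_j W j h)) h a
  = \sum_j W j h * exp_gain (A j) h a.
Proof.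
move=> W0 WT WF; set B := (fun h uv wt => _).
elim=> [|[uv wt] a IH] h; rewrite [exp_gain B h _]/=.
  by rewrite mulr0 big1 // => j _; rewrite mulr0.
(* A zero total makes the quotient a default value; this is harmless, as every [W j h] is then
   zero. *)
have [Z|NZ] := eqVneq (\sum_j W j h) 0.
  rewrite Z mul0r big1 // => j _.
  by rewrite (psumr_eq0P (fun j _ => W0 j h) Z) // mul0r.
have ZB : (\sum_j W j h) * B h uv wt = \sum_j W j (rcons h (uv, wt, true)).
  by rewrite /B mulrC divfK //; apply: eq_bigr => j _; rewrite WT.
have ZB' : (\sum_j W j h) * (1 - B h uv wt) = \sum_j W j (rcons h (uv, wt, false)).
  rewrite mulrBr mulr1 ZB -sumrB; apply: eq_bigr => j _.
  by rewrite WT WF mulrBr mulr1.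
rewrite mulrDr (mulrA _ (B h uv wt)) (mulrA _ (1 - B h uv wt)) ZB ZB'.
rewrite mulrDr !IH mulr_suml -!big_split /=.
by apply: eq_bigr => j _; rewrite WT WF; ring.
Qed.

(** * The length of the sampling phase *)

(** For [m >= 2], [tau] is the last positive index whose harmonic tail [1/tau + ... + 1/(m-1)] is at
    least 1; the products telescope to [tau / t], so the sum is [tau] times this tail. *)
Lemma secretary_threshold {R : realType} (m : nat) :
  exists tau : nat, m%:R / expR 1 <=
    \sum_(tau <= t < m) \prod_(tau <= s < t) (s%:R / s.+1%:R) :> R.
Proof.
have [->|m0] := posnP m; first by exists 0%N; rewrite mul0r big_geq.
pose a t : R := \sum_(t <= s < m) s%:R^-1.
have e0 : 0 < expR 1 :> R by exact: expR_gt0.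
(* For [m = 1] no positive index has such a tail; [tau = 0] admits the only arrival. *)
have [m1|m2] := leqP m 1.
  have -> : m = 1%N by lia.
  exists 0%N; rewrite big_nat1 big_geq // mul1r.
  by rewrite invf_le1 // (le_trans _ (expR_ge1Dx 1)) // lerDl.
have a1 : exists t, (0 < t)%N && (1 <= a t).
  by exists 1%N; rewrite /a big_ltn // invr1 lerDl sumr_ge0.
have abound t : (0 < t)%N && (1 <= a t) -> (t <= m)%N.
  move=> /andP[_]; apply: contraLR; rewrite -ltnNge => mt.
  by rewrite /a big_geq ?(ltnW mt) // ler10.
case: (ex_maxnP a1 abound) => tau /andP[tau0 a_tau] tau_max.
have tau_m : (tau < m)%N.
  rewrite ltnNge; apply/negP => mt; move: a_tau.
  by rewrite /a big_geq // ler10.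
exists tau; set c := a tau.+1.
have c1 : c < 1.
  rewrite ltNge; apply/negP => c1.
  by have := tau_max tau.+1; rewrite c1 ltnn => /(_ isT).
have tau0' : 0 < tau%:R :> R by rewrite ltr0n.
have atau : a tau = tau%:R^-1 + c by rewrite /a big_ltn.
have prodE t : (tau <= t)%N ->
    \prod_(tau <= s < t) (s%:R / s.+1%:R) = tau%:R / t%:R :> R.
  elim: t => [|t IH]; first by rewrite leqn0 => /eqP tz; rewrite tz in tau0.
  rewrite leq_eqVlt => /predU1P[<-|]; first by rewrite big_geq // divff // gt_eqF.
  rewrite ltnS => tt; rewrite big_nat_recr //= IH // mulrA divfK //.
  by rewrite pnatr_eq0 -lt0n; exact: leq_trans tt.
rewrite (eq_big_nat _ _ (F2 := fun t => tau%:R * t%:R^-1)); last first.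
  by move=> t /andP[tt _]; rewrite prodE.
rewrite -mulr_sumr -/(a tau) atau mulrDr divff ?gt_eqF //.
(* Multiplying [1 + 1/s <= expR (1/s)] over [s] gives [m / (tau + 1) <= expR c]. *)
have expc n : (n <= m - tau.+1)%N ->
    ((tau.+1 + n)%:R / tau.+1%:R) <= expR (\sum_(tau.+1 <= s < tau.+1 + n) s%:R^-1) :> R.
  elim: n => [|n IH] nm; first by rewrite addn0 big_geq // expR0 divff // pnatr_eq0.
  rewrite addnS big_nat_recr ?leq_addr //= expRD.
  have -> : (tau.+1 + n).+1%:R / tau.+1%:R
     = ((tau.+1 + n)%:R / tau.+1%:R) * (1 + (tau.+1 + n)%:R^-1) :> R.
    by rewrite -natr1 mulrDr mulr1 mulrAC divff ?pnatr_eq0 // mul1r mulrDl mul1r.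
  apply: ler_pM; rewrite ?divr_ge0 ?addr_ge0 ?ler01 ?invr_ge0 //.
    by apply: IH; lia.
  exact: expR_ge1Dx.
have {expc} := expc _ (leqnn _); rewrite subnKC // -/(a _) -/c => expc.
have expd : 1 + (1 - c) <= expR (1 - c) by exact: expR_ge1Dx.
have expE : expR 1 = expR c * expR (1 - c) by rewrite -expRD addrC subrK.
rewrite ler_pdivrMr // expE.
have m_le : m%:R / tau.+1%:R * (1 + (1 - c)) <= expR c * expR (1 - c).
  by apply: ler_pM => //; rewrite ?divr_ge0 // addr_ge0 // subr_ge0 ltW.
have a_tau' : 1 <= tau%:R^-1 + c by rewrite -atau.
have td : tau%:R * (1 - c) <= 1.
  by rewrite -ler_pdivlMl // mulr1; lra.
have c0 : 0 <= c by rewrite /c /a sumr_ge0.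
apply: (@le_trans _ _ ((1 + tau%:R * c) * (m%:R / tau.+1%:R * (1 + (1 - c))))); last first.
  by apply: ler_wpM2l m_le; rewrite addr_ge0 // mulr_ge0 // ltW.
have -> : (1 + tau%:R * c) * (m%:R / tau.+1%:R * (1 + (1 - c)))
   = m%:R * ((1 + tau%:R * c) * (1 + (1 - c)) / tau.+1%:R) by ring.
rewrite ler_peMr // ler_pdivlMr // mul1r -natr1.
have d0 : 0 <= 1 - c by rewrite subr_ge0 ltW.
(* With [d = 1 - c], the product of [1 + tau c] and [1 + d] exceeds [tau + 1] by [d (1 - tau d)],
   which is nonnegative by the choice of [tau]. *)
have := mulr_ge0 d0 (_ : 0 <= 1 - tau%:R * (1 - c)).
by rewrite subr_ge0 => /(_ td); nra.
Qed.

(** * The offline optimum of the arrived edges *)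

Definition plan_ok {R : realType} {V : finType} {m : nat}
    (v : 'I_m -> V * V * R) (X : {set 'I_m})
    (p : {set 'I_m} * {ffun 'I_m -> bool}) : bool :=
  (p.1 \subset X) &&
  [forall e in p.1, forall f in p.1,
     (tl (v e).1 (p.2 e) == tl (v f).1 (p.2 f)) ==> (e == f)].

(** The condition [e \in X] lets the weight read [v] only on [X], even for pairs that are not
    admissible; [eq_plan] compares the weights as functions of all pairs. *)
Definition plan_weight {R : realType} {V : finType} {m : nat}
    (v : 'I_m -> V * V * R) (X : {set 'I_m})
    (p : {set 'I_m} * {ffun 'I_m -> bool}) : R :=
  \sum_(e in p.1 | e \in X) (v e).2.

(* The offline optimum recomputed by the algorithm is not a maximum forest but a
   maximum-weight set of edges that can be oriented with out-degrees at most one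
   (a bicircular basis): it weighs at least as much as any forest, and the
   orientation is all that the algorithm needs. *)
Definition plan {R : realType} {V : finType} {m : nat}
    (v : 'I_m -> V * V * R) (X : {set 'I_m})
    : {set 'I_m} * {ffun 'I_m -> bool} :=
  [arg max_(p > (finset.set0, [ffun=> false]) | plan_ok v X p) plan_weight v X p]%O.

Lemma plan_spec {R : realType} {V : finType} {m : nat}
    (v : 'I_m -> V * V * R) (X : {set 'I_m}) :
  plan_ok v X (plan v X) /\
  forall p, plan_ok v X p -> plan_weight v X p <= plan_weight v X (plan v X).
Proof.
rewrite /plan; case: arg_maxP => [|p okp pmax]; last by split.
rewrite /plan_ok finset.sub0set /=; apply/forall_inP => e; by rewrite inE.
Qed.

Lemma plan_sub {R : realType} {V : finType} {m : nat}
    (v : 'I_m -> V * V * R) (X : {set 'I_m}) : (plan v X).1 \subset X.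
Proof. by have [/andP[]] := plan_spec v X. Qed.

Lemma plan_inj {R : realType} {V : finType} {m : nat}
    (v : 'I_m -> V * V * R) (X : {set 'I_m}) :
  {in (plan v X).1 &, injective (fun e => tl (v e).1 ((plan v X).2 e))}.
Proof.
move=> e f ep fp E.
have [/andP[_ /forall_inP/(_ e ep)/forall_inP/(_ f fp) H] _] := plan_spec v X.
by move: H; rewrite [X in X == _]E eqxx => /eqP.
Qed.

(** A forest, cut down to [X] and oriented by leaf peeling, is one of the competitors in the
    maximum. *)
Lemma plan_max {R : realType} {V : finType} {m : nat}
    (v : 'I_m -> V * V * R) (X S : {set 'I_m}) :
  (forall e, (v e).1.1 != (v e).1.2) ->
  acyclic (fun e => e \in S) (fun e => (v e).1) ->
  \sum_(e in S | e \in X) (v e).2 <= \sum_(e in (plan v X).1) (v e).2.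
Proof.
move=> nl acS.
have [b binj] := acyclic_orientation nl acS.
have [_ pmax] := plan_spec v X.
rewrite -[leRHS](eq_bigl _ _ (P1 := fun e => (e \in (plan v X).1) && (e \in X))); last first.
  by move=> e; apply: andb_idr; exact: (fintype.subsetP (plan_sub v X)).
rewrite -[leLHS](eq_bigl _ _ (P1 := fun e => (e \in S :&: X) && (e \in X))); last first.
  by move=> e; rewrite inE -andbA andbb.
apply: (pmax (S :&: X, finfun b)).
rewrite /plan_ok /= subsetIr /=; apply/forall_inP => e; rewrite inE => /andP[eS _].
apply/forall_inP => f; rewrite inE => /andP[fS _].
by rewrite !ffunE; apply/implyP => /eqP/(binj _ _ eS fS) ->.
Qed.

(** Both plans maximize the same function under the same constraint, so even ties are broken
    alike. *)
Lemma eq_plan {R : realType} {V : finType} {m : nat}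
    (v v' : 'I_m -> V * V * R) (X : {set 'I_m}) :
  {in X, v =1 v'} -> plan v X = plan v' X.
Proof.
move=> vv'; rewrite /plan; congr Order.arg_max.
- apply/funext => p; rewrite /plan_ok; have [pX|//] := boolP (p.1 \subset X).
  apply: eq_forallb_in => e ep; apply: eq_forallb_in => f fp.
  by rewrite !vv' //; exact: (fintype.subsetP pX).
- by apply/funext => p; apply: eq_bigr => e /andP[_ eX]; rewrite vv'.
Qed.

(** * Random arrival order and the expected weight of the candidates *)

Definition arrived {m : nat} (r : {perm 'I_m}) (t : nat) : {set 'I_m} :=
  [set e | ((r^-1)%g e <= t)%N].

Lemma mem_arrived {m : nat} (r : {perm 'I_m}) (t : nat) (s : 'I_m) :
  (r s \in arrived r t) = (s <= t)%N.
Proof. by rewrite inE permK. Qed.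

(** Swaps inside a prefix replace conditioning on the set of arrived edges: they preserve this set
    and permute the orders bijectively. *)
Lemma arrived_tperm {m : nat} (r : {perm 'I_m}) (t : nat) (i j : 'I_m) :
  (i <= t)%N -> (j <= t)%N -> arrived (tperm i j * r)%g t = arrived r t.
Proof.
move=> it jt; apply/setP => e; rewrite !inE invMg permM tpermV.
by case: tpermP => // ->; rewrite it jt.
Qed.

Definition chosen {R : realType} {V : finType} {m : nat} (r : {perm 'I_m})
    (v : 'I_m -> V * V * R) (s : 'I_m) : bool :=
  r s \in (plan v (arrived r s)).1.

Definition owner {R : realType} {V : finType} {m : nat} (r : {perm 'I_m})
    (v : 'I_m -> V * V * R) (s : 'I_m) : V :=
  tl (v (r s)).1 ((plan v (arrived r s)).2 (r s)).

Definition hit {R : realType} {V : finType} {m : nat} (r : {perm 'I_m})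
    (v : 'I_m -> V * V * R) (u : V) (s : 'I_m) : bool :=
  chosen r v s && (owner r v s == u).

Definition unused {R : realType} {V : finType} {m : nat} (r : {perm 'I_m})
    (v : 'I_m -> V * V * R) (j : nat) (t : 'I_m) : bool :=
  [forall s : 'I_m, (j <= s < t)%N ==> ~~ hit r v (owner r v t) s].

Definition candidate {R : realType} {V : finType} {m : nat} (tau : nat)
    (r : {perm 'I_m}) (v : 'I_m -> V * V * R) (t : 'I_m) : bool :=
  [&& (tau <= t)%N, chosen r v t & unused r v tau t].

Lemma reindex_tperm {R : realType} {m : nat} (i j : 'I_m)
    (F : {perm 'I_m} -> R) : \sum_r F r = \sum_r F (tperm i j * r)%g.
Proof.
rewrite (reindex_inj (h := fun r : {perm 'I_m} => (tperm i j * r)%g)) //.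
exact: mulgI.
Qed.

Lemma hit_tperm {R : realType} {V : finType} {m : nat} (r : {perm 'I_m})
    (v : 'I_m -> V * V * R) (u : V) (i j : 'I_m) : (i <= j)%N ->
  hit (tperm i j * r)%g v u j =
  (r i \in (plan v (arrived r j)).1) &&
  (tl (v (r i)).1 ((plan v (arrived r j)).2 (r i)) == u).
Proof.
by move=> ij; rewrite /hit /chosen /owner arrived_tperm // permM tpermR.
Qed.

Lemma later_tperm {R : realType} {V : finType} {m : nat} (r : {perm 'I_m})
    (v : 'I_m -> V * V * R) (i j s : 'I_m) : (i <= j)%N -> (j < s)%N ->
  [/\ (tperm i j * r)%g s = r s,
      chosen (tperm i j * r)%g v s = chosen r v s &
      owner (tperm i j * r)%g v s = owner r v s].
Proof.
move=> ij js.
have rs : (tperm i j * r)%g s = r s.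
  rewrite permM tpermD //; apply/negP => /eqP E; move: ij js; rewrite E; lia.
by rewrite /chosen /owner rs arrived_tperm //; lia.
Qed.

Lemma sum_uniq_le1 {m : nat} (P : pred 'I_m) :
  {in P &, forall i j, i = j} -> (\sum_i P i <= 1)%N.
Proof.
move=> uP; have [i Pi|P0] := pickP P; last by rewrite big1 // => i _; rewrite P0.
rewrite (bigD1 i) //= big1 ?addn0 ?leq_b1 // => j ji.
case Pj: (P j) => //; by rewrite (uP j i Pj Pi) eqxx in ji.
Qed.

Lemma sum_ord_le_const {R : realType} {m : nat} (j : 'I_m) (c : R) :
  \sum_(i < m | (i <= j)%N) c = j.+1%:R * c.
Proof. by rewrite (big_ord_narrow (ltn_ord j)) sumr_const card_ord mulr_natl. Qed.

(** Swap position [j] with each [i <= j]: the plan at time [j] and everything later stay fixed, and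
    at most one of the [j + 1] swaps hits the owner in question. A hit at [j] thus costs at most the
    fraction [1 / (j + 1)]. *)
Lemma unused_step {R : realType} {V : finType} {m : nat}
    (v : 'I_m -> V * V * R) (j t : 'I_m) :
  (forall e, 0 <= (v e).2) -> (j < t)%N ->
  j%:R / j.+1%:R * (\sum_(r : {perm 'I_m}) (v (r t)).2 *+ (chosen r v t && unused r v j.+1 t))
  <= \sum_(r : {perm 'I_m}) (v (r t)).2 *+ (chosen r v t && unused r v j t).
Proof.
move=> w0 jt.
set G := fun r : {perm 'I_m} => (v (r t)).2 *+ (chosen r v t && unused r v j.+1 t).
(* [H] is the part of [G] lost to a hit at position [j]. *)
pose H (r : {perm 'I_m}) := G r *+ hit r v (owner r v t) j.
have GE (r : {perm 'I_m}) : (v (r t)).2 *+ (chosen r v t && unused r v j t) = G r - H r.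
  have -> : unused r v j t = ~~ hit r v (owner r v t) j && unused r v j.+1 t.
    apply/forallP/andP => [Hj|[nh /forallP Hj] s].
      split; first by have := Hj j; rewrite leqnn jt.
      apply/forallP => s; apply/implyP => /andP[js st].
      by have := Hj s; rewrite (ltnW js) st.
    apply/implyP => /andP[]; rewrite leq_eqVlt => /predU1P[E _|js st].
      by rewrite -(val_inj E).
    by have := Hj s; rewrite js st.
  rewrite /H /G; case: (hit _ _ _ _) => /=; first by rewrite andbF mulr1n subrr.
  by rewrite subr0.
have G0 r : 0 <= G r by rewrite mulrn_wge0.
have Gt (i : 'I_m) (r : {perm 'I_m}) : (i <= j)%N -> G (tperm i j * r)%g = G r.
  move=> ij; have [E1 E2 E3] := later_tperm r v ij jt.
  rewrite /G E1 E2; congr (_ *+ (_ && _)); apply: eq_forallb => s.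
  case: andP => //= -[js st]; have [F1 F2 F3] := later_tperm r v ij js.
  by rewrite /hit F2 F3 E3.
have HG : j.+1%:R * \sum_r H r <= \sum_r G r.
  have HE (i : 'I_m) : (i <= j)%N ->
      \sum_r H r = \sum_r G r *+ hit (tperm i j * r)%g v (owner r v t) j.
    move=> ij; rewrite (reindex_tperm i j); apply: eq_bigr => r _.
    by rewrite /H Gt //; have [_ _ ->] := later_tperm r v ij jt.
  rewrite -sum_ord_le_const (eq_bigr _ HE) exchange_big /=.
  apply: ler_sum => r _; rewrite sumrMnr -[leRHS]mulr1n.
  rewrite ler_wpMn2l // big_mkcond /=.
  pose P (i : 'I_m) := (i <= j)%N && hit (tperm i j * r)%g v (owner r v t) j.
  rewrite (eq_bigr (fun i => nat_of_bool (P i))); last first.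
    by move=> i _; rewrite /P; case: (_ <= _)%N.
  (* Two successful swaps would bring in two edges of one plan with the same owner. *)
  apply: sum_uniq_le1 => i i' /andP[ij Hi] /andP[i'j Hi'].
  move: Hi Hi'; rewrite !hit_tperm // => /andP[p /eqP <-] /andP[p' /eqP E].
  by apply/(@perm_inj _ r)/esym/(plan_inj p' p).
under [leRHS]eq_bigr do rewrite GE.
rewrite sumrB; move: HG; set g := \sum_r G r; set h := \sum_r H r => HG.
have j1 : 0 < j.+1%:R :> R by rewrite ltr0n.
rewrite mulrAC ler_pdivrMr // mulrBl [h * _]mulrC.
rewrite -natr1 mulrDr mulr1 in HG *; lra.
Qed.

(** Start from the empty range of positions before [t] and extend it downwards to [tau], paying one
    factor per position. *)
Lemma unused_prod {R : realType} {V : finType} {m : nat}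
    (v : 'I_m -> V * V * R) (tau : nat) (t : 'I_m) :
  (forall e, 0 <= (v e).2) -> (tau <= t)%N ->
  \prod_(tau <= s < t) (s%:R / s.+1%:R) * (\sum_(r : {perm 'I_m}) (v (r t)).2 *+ chosen r v t)
  <= \sum_(r : {perm 'I_m}) (v (r t)).2 *+ candidate tau r v t.
Proof.
move=> w0 tt.
rewrite (eq_bigr (fun r : {perm 'I_m} =>
  (v (r t)).2 *+ (chosen r v t && unused r v t t))); last first.
  move=> r _; rewrite (_ : unused r v t t) ?andbT //; apply/forallP => s.
  by rewrite leqNgt andNb.
under [leRHS]eq_bigr do rewrite /candidate tt /=.
have : forall k, (k <= t - tau)%N ->
  \prod_(t - k <= s < t) (s%:R / s.+1%:R) *
    (\sum_(r : {perm 'I_m}) (v (r t)).2 *+ (chosen r v t && unused r v t t))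
  <= \sum_(r : {perm 'I_m}) (v (r t)).2 *+ (chosen r v t && unused r v (t - k) t).
  elim=> [|k IH] kt; first by rewrite subn0 big_geq // mul1r.
  have jt : (t - k.+1 < t)%N by lia.
  have jm : (t - k.+1 < m)%N by exact: ltn_trans (ltn_ord t).
  apply: le_trans (unused_step (j := Ordinal jm) w0 jt).
  rewrite /= big_ltn // -mulrA (_ : (t - k.+1).+1 = t - k)%N; last by lia.
  by apply: ler_wpM2l; [rewrite divr_ge0|apply: IH; lia].
by move/(_ _ (leqnn _)); rewrite subKn.
Qed.

(** Each of the [t + 1] arrived edges is equally often the last, so position [t] carries on average
    [1 / (t + 1)] of the plan. The plan outweighs the arrived part of [S], on average [(t + 1) / m]
    of [S]; the factors [t + 1] cancel. *)
Lemma sum_chosen {R : realType} {V : finType} {m : nat}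
    (v : 'I_m -> V * V * R) (S : {set 'I_m}) (t : 'I_m) :
  (forall e, (v e).1.1 != (v e).1.2) -> (forall e, 0 <= (v e).2) ->
  acyclic (fun e => e \in S) (fun e => (v e).1) ->
  #|{perm 'I_m}|%:R * (\sum_(e in S) (v e).2) <=
  m%:R * \sum_(r : {perm 'I_m}) (v (r t)).2 *+ chosen r v t.
Proof.
move=> nl w0 acS; set C := \sum_r _.
have CE (i : 'I_m) : (i <= t)%N ->
    C = \sum_(r : {perm 'I_m}) (v (r i)).2 *+ (r i \in (plan v (arrived r t)).1).
  move=> it; rewrite /C (reindex_tperm i t); apply: eq_bigr => r _.
  by rewrite /chosen arrived_tperm // permM tpermR.
(* Every edge occupies position [i] in one [m]-th of all orders. *)
have NE (e i : 'I_m) : m%:R * (\sum_(r : {perm 'I_m}) (r i == e)%:R) = #|{perm 'I_m}|%:R :> R.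
  have -> : m%:R * (\sum_(r : {perm 'I_m}) (r i == e)%:R)
     = \sum_(j < m) \sum_(r : {perm 'I_m}) (r j == e)%:R :> R.
    rewrite [RHS](eq_bigr (fun=> \sum_(r : {perm 'I_m}) (r i == e)%:R)).
      by rewrite sumr_const card_ord mulr_natl.
    move=> j _; rewrite (reindex_tperm i j); apply: eq_bigr => r _.
    by rewrite permM tpermR.
  rewrite exchange_big /= (eq_bigr (fun=> 1)); first by rewrite sumr_const.
  move=> r _; rewrite (bigD1 ((r^-1)%g e)) //= permKV eqxx big1 ?addr0 // => j.
  by apply: contraNeq; rewrite pnatr_eq0 eqb0 negbK => /eqP <-; rewrite permK.
have C1 : t.+1%:R * C >= \sum_(r : {perm 'I_m}) \sum_(e in S | e \in arrived r t) (v e).2.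
  rewrite -sum_ord_le_const (eq_bigr _ CE) exchange_big /=.
  apply: ler_sum => r _; apply: le_trans (plan_max _ nl acS) _.
  rewrite (reindex_inj (@perm_inj _ r)) /= [leLHS]big_mkcond [leRHS]big_mkcond /=.
  apply: ler_sum => i _; case: ifPn => [ip|ip].
    have := fintype.subsetP (plan_sub v (arrived r t)) _ ip.
    by rewrite mem_arrived => ->.
  by case: ifP => // _; rewrite mulr0n.
rewrite -(ler_pM2l (_ : 0 < t.+1%:R)) ?ltr0n // mulrCA [leRHS]mulrCA.
apply: le_trans (ler_wpM2l (ler0n _ m) C1); rewrite le_eqVlt; apply/predU1P; left.
under [in RHS]eq_bigr do rewrite big_mkcondr.
rewrite exchange_big /= mulr_sumr !mulr_sumr; apply: eq_bigr => e eS.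
rewrite (eq_bigr (fun r : {perm 'I_m} =>
  \sum_(i < m | (i <= t)%N) (v e).2 * (r i == e)%:R)); last first.
  move=> r _; rewrite -mulr_sumr; case: ifPn => eA.
    rewrite (bigD1 ((r^-1)%g e)) /=; last by rewrite inE in eA.
    rewrite permKV eqxx big1 ?addr0 ?mulr1 // => j /andP[_].
    by apply: contraNeq; rewrite pnatr_eq0 eqb0 negbK => /eqP <-; rewrite permK.
  rewrite big1 ?mulr0 // => j jt; apply/eqP; rewrite pnatr_eq0 eqb0.
  by apply: contraNN eA => /eqP <-; rewrite mem_arrived.
rewrite exchange_big /= mulr_sumr.
under eq_bigr do rewrite -mulr_sumr mulrCA NE.
by rewrite sum_ord_le_const; ring.
Qed.

Lemma candidate_weight {R : realType} {V : finType} {m : nat}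
    (v : 'I_m -> V * V * R) (S : {set 'I_m}) (tau : nat) :
  (forall e, (v e).1.1 != (v e).1.2) -> (forall e, 0 <= (v e).2) ->
  acyclic (fun e => e \in S) (fun e => (v e).1) ->
  m%:R / expR 1 <= \sum_(tau <= t < m) \prod_(tau <= s < t) (s%:R / s.+1%:R) :> R ->
  #|{perm 'I_m}|%:R * (\sum_(e in S) (v e).2) / expR 1 <=
  \sum_(r : {perm 'I_m}) \sum_t (v (r t)).2 *+ candidate tau r v t.
Proof.
move=> nl w0 acS tauP.
have [m0|m0] := posnP m.
  rewrite big1 ?mulr0 ?mul0r; last first.
    by move=> e _; have := leq_trans (leq_ltn_trans (leq0n e) (ltn_ord e)) (eq_leq m0).
  by apply: sumr_ge0 => r _; apply: sumr_ge0 => t _; rewrite mulrn_wge0.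
rewrite exchange_big /=; set W := \sum_(e in S) _; set N := #|_|%:R.
have W0 : 0 <= N * W by rewrite mulr_ge0 // sumr_ge0.
have m0' : 0 < m%:R :> R by rewrite ltr0n.
have step (t : 'I_m) : (tau <= t)%N ->
    N * W / m%:R * \prod_(tau <= s < t) (s%:R / s.+1%:R)
    <= \sum_(r : {perm 'I_m}) (v (r t)).2 *+ candidate tau r v t.
  move=> tt; apply: le_trans (unused_prod w0 tt).
  rewrite mulrC; apply: ler_wpM2l; first by apply: prodr_ge0 => s _; rewrite divr_ge0.
  by rewrite ler_pdivrMr // [leRHS]mulrC; exact: sum_chosen.
apply: (@le_trans _ _ (\sum_(t < m | (tau <= t)%N) N * W / m%:R *
  \prod_(tau <= s < t) (s%:R / s.+1%:R))); last first.
  rewrite [leRHS](bigID (fun t : 'I_m => (tau <= t)%N)) /= -[leLHS]addr0.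
  apply: lerD; first by apply: ler_sum => t tt; exact: step.
  by apply: sumr_ge0 => t _; apply: sumr_ge0 => r _; rewrite mulrn_wge0.
rewrite -mulr_sumr.
have -> : \sum_(t < m | (tau <= t)%N) \prod_(tau <= s < t) (s%:R / s.+1%:R)
    = \sum_(tau <= t < m) \prod_(tau <= s < t) (s%:R / s.+1%:R) :> R.
  rewrite -(big_mkord (fun t => tau <= t)%N
    (fun t => \prod_(tau <= s < t) (s%:R / s.+1%:R : R))).
  by rewrite [RHS](big_nat_widenl _ 0%N) //; apply: eq_bigl.
apply: le_trans (ler_wpM2l _ tauP); last by rewrite divr_ge0.
by rewrite mulrA divfK // gt_eqF.
Qed.

(** Of two candidates with one owner, the earlier would be a hit that disqualifies the later. *)
Lemma owner_inj {R : realType} {V : finType} {m : nat} (tau : nat)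
    (r : {perm 'I_m}) (v : 'I_m -> V * V * R) :
  {in candidate tau r v &, injective (owner r v)}.
Proof.
have lt_neq (s t : 'I_m) : candidate tau r v s -> candidate tau r v t ->
    (s < t)%N -> owner r v s <> owner r v t.
  move=> /and3P[ts cs _] /and3P[_ _ /forallP/(_ s)].
  by rewrite /hit ts cs /= => /implyP H st E; rewrite E eqxx in H; move/H: st.
move=> s t cs ct E; have [lt|gt|/val_inj//] := ltngtP s t.
  by case: (lt_neq s t cs ct lt).
by case: (lt_neq t s ct cs gt).
Qed.

(** * Coin flips and acyclicity of the accepted edges *)

Definition closes {R : realType} {V : finType} {m : nat} (tau : nat)
    (r : {perm 'I_m}) (v : 'I_m -> V * V * R) (t : 'I_m) (Q : {set 'I_m}) : bool :=
  [&& t \in Q, [forall p in Q, (p <= t)%N && candidate tau r v p]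
    & `[< is_cycle (fun p => (v (r p)).1) (mem Q) >]].

(* [c] is the set of positions whose coin shows heads. A candidate that closes
   no cycle of candidates is accepted on heads; one that does is accepted unless
   all the other edges of that cycle show heads, that is, are accepted. *)
Definition accept {R : realType} {V : finType} {m : nat} (tau : nat)
    (r : {perm 'I_m}) (v : 'I_m -> V * V * R) (c : {set 'I_m}) (t : 'I_m) : bool :=
  candidate tau r v t &&
  (if [pick Q | closes tau r v t Q] is Some Q then ~~ (Q :\ t \subset c)
   else t \in c).

(** By [cycle_sub] the two cycles contain each other's last position. *)
Lemma closes_uniq {R : realType} {V : finType} {m : nat} (tau : nat)
    (r : {perm 'I_m}) (v : 'I_m -> V * V * R) (s t p : 'I_m) (Q Q' : {set 'I_m}) :
  closes tau r v s Q -> closes tau r v t Q' -> p \in Q -> p \in Q' -> s = t.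
Proof.
move=> /and3P[sQ /forall_inP QC /asboolP cQ] /and3P[tQ' /forall_inP QC' /asboolP cQ'] pQ pQ'.
have inj : {in candidate tau r v &, injective (fun p => tl (v (r p)).1
    ((plan v (arrived r p)).2 (r p)))} by exact: owner_inj.
have QS : {subset mem Q <= candidate tau r v} by move=> q /QC/andP[].
have QS' : {subset mem Q' <= candidate tau r v} by move=> q /QC'/andP[].
have sQ' := cycle_sub inj QS QS' cQ cQ' pQ pQ' sQ.
have tQ := cycle_sub inj QS' QS cQ' cQ pQ' pQ tQ'.
apply: val_inj; apply/eqP; rewrite eqn_leq.
by have /andP[-> _] := QC' _ sQ'; have /andP[-> _] := QC _ tQ.
Qed.

(** The last position [t] of an accepted cycle closes it, and only it, so some other position [q] on
    it shows tails. By [closes_uniq], [q] closes no cycle, hence was accepted on heads: a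
    contradiction. *)
Lemma accepted_acyclic {R : realType} {V : finType} {m : nat} (tau : nat)
    (r : {perm 'I_m}) (v : 'I_m -> V * V * R) (c : {set 'I_m}) :
  acyclic (fun p => accept tau r v c p) (fun p => (v (r p)).1).
Proof.
move=> k Hk; have [Q [cQ cardQ QA]] := (is_cycleP _ _ _).1 Hk.
have [p0 p0Q] : exists p, p \in Q.
  by apply/card_gt0P; rewrite cardQ; case: Hk => /ltnW.
have [t tQ tmax] := @arg_maxnP _ p0 (mem Q) (@nat_of_ord m) p0Q.
have clQ : closes tau r v t Q.
  apply/and3P; split=> //; last exact/asboolP.
  by apply/forall_inP => p pQ; rewrite [(p <= t)%N](tmax p pQ); have /andP[] := QA _ pQ.
have /andP[_] := QA _ tQ; case: pickP => [Q0 clQ0|/(_ Q)]; last by rewrite clQ.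
have Q0Q : Q0 = Q.
  have [tQ0 _ _] := and3P clQ0.
  have inj : {in candidate tau r v &, injective (fun p => tl (v (r p)).1
    ((plan v (arrived r p)).2 (r p)))} by exact: owner_inj.
  have QS : {subset mem Q <= candidate tau r v} by move=> q /QA/andP[].
  have /and3P[_ /forall_inP QC0 /asboolP cQ0] := clQ0.
  have QS0 : {subset mem Q0 <= candidate tau r v} by move=> q /QC0/andP[].
  apply/setP => p; apply/idP/idP => pin.
    exact: (cycle_sub inj QS0 QS cQ0 cQ tQ0 tQ pin).
  exact: (cycle_sub inj QS QS0 cQ cQ0 tQ tQ0 pin).
rewrite {}Q0Q => /subsetPn[q]; rewrite !inE => /andP[qt qQ] qc.
have /andP[_] := QA _ qQ; case: pickP => [Q1 clQ1|_]; last by rewrite (negPf qc).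
have [qQ1 _ _] := and3P clQ1.
by rewrite (closes_uniq clQ1 clQ qQ1 qQ) eqxx in qt.
Qed.

Definition coin_weight {R : realType} {m : nat} (x : R) (c : {set 'I_m}) : R :=
  \prod_i (if i \in c then x else 1 - x).

Lemma coin_weight_ge0 {R : realType} {m : nat} (x : R) (c : {set 'I_m}) :
  0 <= x <= 1 -> 0 <= coin_weight x c.
Proof.
move=> /andP[x0 x1]; apply: prodr_ge0 => i _; case: ifP => // _.
by rewrite subr_ge0.
Qed.

(** Expand a product of sums in which the tails term is erased at the positions of [P]; every other
    factor is [x + (1 - x) = 1]. *)
Lemma sum_coin_weight_sub {R : realType} {m : nat} (x : R) (P : {set 'I_m}) :
  \sum_c coin_weight x c *+ (P \subset c) = x ^+ #|P|.
Proof.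
transitivity (\prod_(i < m) (x + (if i \in P then 0 else 1 - x))).
  rewrite bigA_distr; apply: eq_bigr => c _.
  have [Pc|/subsetPn[i iP ic]] := boolP (P \subset c).
    rewrite mulr1n; apply: eq_bigr => i _; case: ifPn => // ic.
    by rewrite ifN //; apply: contraNN ic; exact: fintype.subsetP.
  by rewrite mulr0n (bigD1 i) //= (negPf ic) iP mul0r.
rewrite -prodr_const [RHS]big_mkcond /=; apply: eq_bigr => i _.
by case: ifP => _; rewrite ?addr0 // addrC subrK.
Qed.

Lemma sum_coin_weight {R : realType} {m : nat} (x : R) :
  \sum_(c : {set 'I_m}) coin_weight x c = 1.
Proof.
rewrite -(expr0 x) -(cards0 ('I_m : finType)) -sum_coin_weight_sub.
by apply: eq_bigr => c _; rewrite finset.sub0set.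
Qed.

Lemma accept_prob {R : realType} {V : finType} {m : nat} (tau g : nat) (x : R)
    (r : {perm 'I_m}) (v : 'I_m -> V * V * R) (t : 'I_m) :
  (0 < g)%N -> 0 <= x <= 1 -> - x ^+ g.-1 - x + 1 = 0 ->
  girth_ge (fun e => (v e).1) g -> candidate tau r v t ->
  x <= \sum_c coin_weight x c *+ accept tau r v c t.
Proof.
move=> g0 /andP[x0 x1] xg girth ct; rewrite /accept ct /=.
case: pickP => [Q /and3P[tQ _ /asboolP cQ]|_]; last first.
  rewrite -[X in X <= _]expr1 -(cards1 t) -sum_coin_weight_sub.
  by apply: ler_sum => c _; rewrite finset.sub1set.
have -> : \sum_c coin_weight x c *+ ~~ (Q :\ t \subset c) = 1 - x ^+ #|Q :\ t|.
  rewrite -(sum_coin_weight (m := m) x) -sum_coin_weight_sub -sumrB.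
  by apply: eq_bigr => c _; case: (_ \subset _); rewrite ?subrr ?subr0.
(* The girth bounds the cycle in the labels [r p]; injectivity of [r] carries it over to
   positions. *)
have gQ : (g.-1 <= #|Q :\ t|)%N.
  have := cardsD1 t Q; rewrite tQ add1n => QE.
  suff gQ : (g <= #|Q|)%N by rewrite -ltnS -QE prednK.
  rewrite leqNgt; apply/negP => /girth; apply.
  apply: (has_cycle_map (f := r) (S := fun=> True)
    (ends := fun p => (v (r p)).1)) => //; first exact: perm_inj.
  by apply/is_cycleP; exists Q.
have := ler_wiXn2l x0 x1 gQ; lra.
Qed.

(** * Decisions depend on the past only *)

Lemma is_cycle_ext {I V : eqType} (ends ends' : I -> V * V) (Q : pred I) :
  {in Q, ends =1 ends'} -> is_cycle ends Q -> is_cycle ends' Q.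
Proof.
move=> E [k [es [vs [k2 es_inj vs_inj cyc Qes]]]]; exists k, es, vs; split=> //.
by move=> i ik; rewrite -E; [exact: cyc|apply/Qes; exists i].
Qed.

Lemma eq_candidate {R : realType} {V : finType} {m : nat} (tau : nat)
    (r : {perm 'I_m}) (v v' : 'I_m -> V * V * R) (t : 'I_m) :
  {in arrived r t, v =1 v'} -> candidate tau r v t = candidate tau r v' t.
Proof.
move=> vv'.
have vs (s : 'I_m) : (s <= t)%N ->
    chosen r v s = chosen r v' s /\ owner r v s = owner r v' s.
  move=> st; rewrite /chosen /owner vv' ?mem_arrived // (eq_plan (v' := v')) //.
  by move=> e; rewrite inE => es; apply: vv'; rewrite inE (leq_trans es).
rewrite /candidate /unused (vs t _).1 //; congr [&& _, _ & _].
apply: eq_forallb => s; case: andP => //= -[_ st].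
by rewrite /hit !(vs s (ltnW st)).1 !(vs s (ltnW st)).2 (vs t _).2.
Qed.

(** This makes the rule online: it may be evaluated with arbitrary values for edges yet to come. *)
Lemma eq_accept {R : realType} {V : finType} {m : nat} (tau : nat)
    (r : {perm 'I_m}) (v v' : 'I_m -> V * V * R) (c : {set 'I_m}) (t : 'I_m) :
  {in arrived r t, v =1 v'} -> accept tau r v c t = accept tau r v' c t.
Proof.
have sub (u u' : 'I_m -> V * V * R) Q : {in arrived r t, u =1 u'} ->
    closes tau r u t Q -> closes tau r u' t Q.
  move=> uu' /and3P[tQ /forall_inP QC /asboolP cQ]; apply/and3P; split=> //.
    apply/forall_inP => p pQ; have /andP[pt cp] := QC _ pQ.
    have uu : {in arrived r p, u =1 u'}.
      by move=> e; rewrite inE => ep; apply: uu'; rewrite inE (leq_trans ep).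
    by rewrite pt -(eq_candidate tau uu).
  apply/asboolP; apply: is_cycle_ext cQ => p pQ.
  by rewrite uu' // mem_arrived; have /andP[] := QC _ pQ.
move=> vv'; rewrite /accept (eq_candidate tau vv').
suff -> : [pick Q | closes tau r v t Q] = [pick Q | closes tau r v' t Q] by [].
apply: eq_pick => Q; apply/idP/idP; apply: sub => // e eA.
by rewrite vv'.
Qed.

(** * The algorithm with a fixed seed *)

Lemma acyclic_tnth {I : finType} {V : eqType} (ends : I -> V * V)
    (S : I -> Prop) (l : seq I) :
  uniq l -> (forall i, i \in l -> S i) -> acyclic S ends ->
  acyclic (fun=> True) (tnth (in_tuple [seq ends i | i <- l])).
Proof.
move=> ul lS acS k Hk; apply: (acS k).
pose f (i : 'I_(size [seq ends i | i <- l])) :=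
  tnth (in_tuple l) (cast_ord (size_map ends l) i).
apply: (has_cycle_map (f := f) (S := fun=> True)) Hk.
- by move=> i j /(elimT (tuple_uniqP (in_tuple l)) ul)/cast_ord_inj.
- by move=> i _; apply: lS; rewrite mem_tnth.
- move=> i; rewrite /f (tnth_nth (ends (f i))) (tnth_nth (f i)) /=.
  by rewrite (nth_map (f i)) // -(size_map ends l).
Qed.

(** The instance is rebuilt from the history as if [r] were the arrival order, future edges being
    filled in with the current one. The acyclicity test secures validity on arbitrary histories, and
    arrivals beyond the [m]-th are rejected. *)
Definition seeded_alg {R : realType} (V : finType) (m tau : nat)
    (r : {perm 'I_m}) (c : {set 'I_m}) (h : seq ((V * V) * R * bool))
    (uv : V * V) (wt : R) : R :=
  if insub (size h) is Some t then
    (accept tau r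
       (fun e => nth (uv, wt) (rcons [seq y.1 | y <- h] (uv, wt)) ((r^-1)%g e)) c t
     && `[< acyclic (fun=> True) (tnth (in_tuple (rcons (accepted_ends h) uv))) >])%:R
  else 0.

(** When [r] is the true order, the rebuilt instance agrees with [v] on all arrived edges, and the
    acyclicity test never overrules an acceptance. *)
Lemma seeded_alg_run {R : realType} {V : finType} {m : nat} (tau : nat)
    (r : {perm 'I_m}) (c : {set 'I_m}) (v : 'I_m -> V * V * R)
    (l l' : seq 'I_m) (t : 'I_m) : enum 'I_m = l ++ t :: l' ->
  seeded_alg tau r c [seq (v (r s), accept tau r v c s) | s <- l]
    (v (r t)).1 (v (r t)).2 = (accept tau r v c t)%:R.
Proof.
move=> El.
have sl : size l = t.
  have := enum_uniq 'I_m; rewrite El cat_uniq /= => /and3P[_ /norP[tl _] _].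
  by have := index_enum_ord t; rewrite El index_cat (negPf tl) /= eqxx addn0.
have El' : enum 'I_m = rcons l t ++ l' by rewrite cat_rcons.
rewrite /seeded_alg size_map sl valK.
rewrite -surjective_pairing -!map_comp.
have -> : rcons (map ((fun y => y.1) \o (fun s => (v (r s), accept tau r v c s))) l) (v (r t))
    = [seq v (r s) | s <- rcons l t] by rewrite map_rcons.
rewrite (@eq_accept _ _ _ _ _ _ v); last first.
  move=> e; rewrite inE => et.
  rewrite (nth_map t) ?size_rcons ?sl ?ltnS //.
  have := nth_ord_enum t ((r^-1)%g e).
  by rewrite El' nth_cat size_rcons sl ltnS et => ->; rewrite permKV.
have [at_|//] := boolP (accept tau r v c t).
rewrite /= asboolT //.
have -> : rcons (accepted_ends [seq (v (r s), accept tau r v c s) | s <- l]) (v (r t)).1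
    = [seq (v (r s)).1 | s <- [seq s <- rcons l t | accept tau r v c s]].
  by rewrite filter_rcons at_ map_rcons /accepted_ends filter_map -map_comp.
apply: acyclic_tnth (@accepted_acyclic _ _ _ tau r v c).
  apply: filter_uniq; have := enum_uniq 'I_m.
  by rewrite El' cat_uniq => /andP[].
by move=> s; rewrite mem_filter => /andP[].
Qed.

Lemma seeded_alg_gain {R : realType} {V : finType} {m : nat} (tau : nat)
    (r : {perm 'I_m}) (c : {set 'I_m}) (v : 'I_m -> V * V * R) :
  exp_gain (seeded_alg tau r c) [::] [seq v (r t) | t <- enum 'I_m]
  = \sum_t (v (r t)).2 *+ accept tau r v c t.
Proof.
rewrite -big_enum /=.
suff gain l' l : enum 'I_m = l ++ l' ->
    exp_gain (seeded_alg tau r c) [seq (v (r s), accept tau r v c s) | s <- l]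
      [seq v (r t) | t <- l']
    = \sum_(t <- l') (v (r t)).2 *+ accept tau r v c t by exact: (gain _ [::]).
elim: l' l => [|t l' IH] l El; first by rewrite big_nil.
rewrite big_cons /= (seeded_alg_run _ _ _ _ El) -surjective_pairing.
have := IH (rcons l t); rewrite cat_rcons map_rcons => /(_ El) <-.
by case: (accept tau r v c t);
  rewrite /= ?subrr ?subr0 !(mul1r, mul0r) ?addr0 // mulr0n !add0r.
Qed.

Lemma seeded_alg_valid {R : realType} {V : finType} {m : nat} (tau : nat)
    (r : {perm 'I_m}) (c : {set 'I_m}) (h : seq ((V * V) * R * bool))
    (uv : V * V) (wt : R) :
  0 <= seeded_alg tau r c h uv wt <= 1 /\
  (~ acyclic (fun=> True) (tnth (in_tuple (rcons (accepted_ends h) uv))) ->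
   seeded_alg tau r c h uv wt = 0).
Proof.
rewrite /seeded_alg; case: insub => [t|]; last by split=> //; rewrite lexx ler01.
split; first by rewrite ler0n lern1 leq_b1.
by move=> nac; rewrite asboolF // andbF.
Qed.

(** * From a random seed to a behavioural algorithm *)

(** The probability that [A], started after [h0], takes the decisions recorded in [h]. *)
Fixpoint likelihood {R : realType} {V : Type}
    (A : seq ((V * V) * R * bool) -> V * V -> R -> R)
    (h0 h : seq ((V * V) * R * bool)) : R :=
  if h is y :: h' then
    (if y.2 then A h0 y.1.1 y.1.2 else 1 - A h0 y.1.1 y.1.2) *
    likelihood A (rcons h0 y) h'
  else 1.

Lemma likelihood_rcons {R : realType} {V : Type}
    (A : seq ((V * V) * R * bool) -> V * V -> R -> R)
    (h0 h : seq ((V * V) * R * bool)) (y : (V * V) * R * bool) :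
  likelihood A h0 (rcons h y) = likelihood A h0 h *
    (if y.2 then A (h0 ++ h) y.1.1 y.1.2 else 1 - A (h0 ++ h) y.1.1 y.1.2).
Proof.
elim: h h0 => [|z h IH] h0 /=; first by rewrite cats0 mulr1 mul1r.
by rewrite IH cat_rcons mulrA.
Qed.

Definition seed_weight {R : realType} {m : nat} (x : R)
    (j : {perm 'I_m} * {set 'I_m}) : R :=
  #|{perm 'I_m}|%:R^-1 * coin_weight x j.2.

Definition posterior {R : realType} (V : finType) (m tau : nat) (x : R)
    (j : {perm 'I_m} * {set 'I_m}) (h : seq ((V * V) * R * bool)) : R :=
  seed_weight x j * likelihood (seeded_alg tau j.1 j.2) [::] h.

(* The behavioural form of the algorithm that draws its whole seed (tie-breaking
   labels and coins) in advance: the acceptance probabilities of the seeded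
   algorithms are averaged against the posterior of the seed given the history.
   The seed [r] pretends to be the arrival order; labelling the edges by it
   breaks ties between edges that the algorithm could not tell apart. *)
Definition secretary_alg {R : realType} (tau : nat -> nat) (x : R) : online_alg R :=
  fun V m h uv wt =>
    (\sum_(j : {perm 'I_m} * {set 'I_m})
        posterior (tau m) x j h * seeded_alg (tau m) j.1 j.2 h uv wt) /
    (\sum_(j : {perm 'I_m} * {set 'I_m}) posterior (tau m) x j h).

Lemma posterior_ge0 {R : realType} (V : finType) (m tau : nat) (x : R)
    (j : {perm 'I_m} * {set 'I_m}) (h : seq ((V * V) * R * bool)) :
  0 <= x <= 1 -> 0 <= posterior tau x j h.
Proof.
move=> x01; rewrite mulr_ge0 // ?mulr_ge0 ?invr_ge0 ?coin_weight_ge0 //.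
elim/last_ind: h => [|h y IH]; first exact: ler01.
rewrite likelihood_rcons mulr_ge0 //.
have [/andP[A0 A1] _] := seeded_alg_valid tau j.1 j.2 h y.1.1 y.1.2.
by case: ifP; rewrite ?subr_ge0.
Qed.

Lemma secretary_alg_valid {R : realType} (tau : nat -> nat) (x : R) :
  0 <= x <= 1 -> valid_alg (secretary_alg tau x).
Proof.
move=> x01 V m h uv wt; rewrite /secretary_alg; set Z := \sum_j posterior _ _ _ _.
have Z0 : 0 <= Z by apply: sumr_ge0 => j _; exact: posterior_ge0.
have valid (j : {perm 'I_m} * {set 'I_m}) := seeded_alg_valid (tau m) j.1 j.2 h uv wt.
split; last first.
  move=> nac; rewrite big1 ?mul0r // => j _.
  by have [_ ->] := valid j; rewrite ?mulr0.
apply/andP; split.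
  rewrite divr_ge0 // sumr_ge0 // => j _; rewrite mulr_ge0 ?posterior_ge0 //.
  by have [/andP[]] := valid j.
(* On a history that no seed produces, division by zero yields probability 0. *)
have [->|Zn] := eqVneq Z 0; first by rewrite invr0 mulr0 ler01.
rewrite ler_pdivrMr ?lt0r ?Zn // mul1r; apply: ler_sum => j _.
by rewrite ler_piMr ?posterior_ge0 //; have [/andP[]] := valid j.
Qed.

Lemma secretary_alg_gain {R : realType} {V : finType} {m : nat}
    (tau : nat -> nat) (x : R) (a : seq ((V * V) * R)) : 0 <= x <= 1 ->
  exp_gain (@secretary_alg R tau x V m) [::] a =
  #|{perm 'I_m}|%:R^-1 * \sum_(r : {perm 'I_m}) \sum_(c : {set 'I_m})
    coin_weight x c * exp_gain (seeded_alg (tau m) r c) [::] a.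
Proof.
move=> x01.
have prior1 : \sum_(j : {perm 'I_m} * {set 'I_m}) posterior (V := V) (tau m) x j [::] = 1.
  rewrite /posterior /seed_weight /=.
  rewrite -(pair_bigA _ (fun (r : {perm 'I_m}) c =>
    #|{perm 'I_m}|%:R^-1 * coin_weight x c * 1)) /=.
  under eq_bigr do rewrite -mulr_suml mulr1 -mulr_sumr sum_coin_weight mulr1.
  rewrite sumr_const -[LHS]mulr_natr mulVf // pnatr_eq0 -lt0n; apply/card_gt0P.
  by exists 1%g.
rewrite -[LHS]mul1r -[X in X * _ = _]prior1 mixture_exp_gain.
- rewrite /posterior /seed_weight mulr_sumr.
  rewrite -(pair_bigA _ (fun (r : {perm 'I_m}) c =>
    #|{perm 'I_m}|%:R^-1 * coin_weight x c * 1 *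
      exp_gain (seeded_alg (tau m) r c) [::] a)) /=.
  apply: eq_bigr => r _; rewrite mulr_sumr; apply: eq_bigr => c _.
  by rewrite mulr1 mulrA.
- by move=> j h; exact: posterior_ge0.
- by move=> j h uv wt; rewrite /posterior likelihood_rcons mulrA.
- by move=> j h uv wt; rewrite /posterior likelihood_rcons mulrA.
Qed.

(** * The competitive ratio *)

(** Here the seed [r] is the arrival order itself. For each candidate the coins contribute the
    factor [x], and the average over [r] contributes [1 / e]. *)
Lemma seeded_alg_weight {R : realType} {V : finType} {m : nat} (tau g : nat)
    (x : R) (v : 'I_m -> V * V * R) (S : {set 'I_m}) :
  (0 < g)%N -> 0 <= x <= 1 -> - x ^+ g.-1 - x + 1 = 0 ->
  (forall e, (v e).1.1 != (v e).1.2) -> (forall e, 0 <= (v e).2) ->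
  girth_ge (fun e => (v e).1) g ->
  acyclic (fun e => e \in S) (fun e => (v e).1) ->
  m%:R / expR 1 <= \sum_(tau <= t < m) \prod_(tau <= s < t) (s%:R / s.+1%:R) :> R ->
  x / expR 1 * (#|{perm 'I_m}|%:R * \sum_(e in S) (v e).2) <=
  \sum_(r : {perm 'I_m}) \sum_(c : {set 'I_m}) coin_weight x c *
    exp_gain (seeded_alg tau r c) [::] [seq v (r t) | t <- enum 'I_m].
Proof.
move=> g0 x01 xg nl w0 girth acS tauP; have /andP[x0 _] := x01.
rewrite [leLHS]mulrAC -mulrA.
apply: le_trans (ler_wpM2l x0 (candidate_weight nl w0 acS tauP)) _.
rewrite mulr_sumr; apply: ler_sum => r _.
under [leRHS]eq_bigr do rewrite seeded_alg_gain mulr_sumr.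
rewrite exchange_big mulr_sumr /=; apply: ler_sum => t _.
under [leRHS]eq_bigr do rewrite mulrnAr -mulrnAl.
rewrite -mulr_suml; have [ct|_] := boolP (candidate tau r v t).
  by rewrite mulr1n; apply: ler_wpM2r => //; exact: (accept_prob g0 x01 xg girth ct).
rewrite mulr0n mulr0 mulr_ge0 // sumr_ge0 // => c _.
by rewrite mulrn_wge0 // coin_weight_ge0.
Qed.

Lemma OPT_attained {R : realType} {V : finType} (m : nat)
    (ends : 'I_m -> V * V) (w : 'I_m -> R) :
  exists2 S : {set 'I_m}, acyclic (fun e => e \in S) ends &
    OPT ends w = \sum_(e in S) w e.
Proof.
rewrite /OPT; apply: (big_ind (fun y => exists2 S : {set 'I_m},
    acyclic (fun e => e \in S) ends & y = \sum_(e in S) w e)).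
- exists finset.set0; last by rewrite finset.big_set0.
  move=> k [k2 [es [vs [_ _ H]]]].
  by have [] := H 0%N (ltnW k2); rewrite inE.
- by move=> y z Hy Hz; case: (leP y z).
- by move=> S /asboolP acS; exists S.
Qed.

Unset Implicit Arguments.

Theorem theorem2 (R : realType) (g : nat) (x eps : R) :
  (2 <= g)%N ->
  0 <= x <= 1 -> - x ^+ g.-1 - x + 1 = 0 ->
  0 < eps ->
  exists alg : online_alg R,
    valid_alg alg /\
    forall (V : finType) (m : nat) (ends : 'I_m -> V * V) (w : 'I_m -> R),
      loopless ends -> (forall e, 0 <= w e) -> girth_ge ends g ->
      (x / expR 1 - eps) * OPT ends w <= expected_alg alg ends w.
Proof.
move=> g2 x01 xg eps0.
have [tau tauP] := choice (@secretary_threshold R).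
exists (secretary_alg tau x); split; first exact: secretary_alg_valid.
move=> V m ends w nl w0 girth; have [S acS ->] := OPT_attained ends w.
set W := \sum_(e in S) w e.
have W0 : 0 <= W by exact: sumr_ge0.
apply: (@le_trans _ _ (x / expR 1 * W)); first by apply: ler_wpM2r => //; lra.
set N : R := #|{perm 'I_m}|%:R.
have N0 : 0 < N by rewrite ltr0n; apply/card_gt0P; exists 1%g.
rewrite /expected_alg -/N.
under eq_bigr do rewrite secretary_alg_gain //.
rewrite -/N -mulr_sumr mulrA -invfM [leRHS]mulrC ler_pdivlMr ?mulr_gt0 //.
(* The true order [s] and the seed [r] are independent. Writing [s = r * q] turns the run into one
   on the instance relabelled by [q], whose arrival order is exactly [r]. *)
have relabel (F : {perm 'I_m} -> {perm 'I_m} -> R) :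
    \sum_s \sum_r F s r = \sum_q \sum_r F (r * q)%g r.
  rewrite exchange_big [RHS]exchange_big; apply: eq_bigr => r _.
  by rewrite (reindex_inj (mulgI r)).
rewrite relabel.
have -> : x / expR 1 * W * (N * N) = \sum_(q : {perm 'I_m}) x / expR 1 * (N * W).
  rewrite sumr_const -[RHS]mulr_natr -/N; ring.
apply: ler_sum => q _.
pose v e := (ends (q e), w (q e)).
have -> : W = \sum_(e in q @^-1: S) (v e).2.
  rewrite /W (reindex_inj (@perm_inj _ q)) /=.
  by apply: eq_bigl => e; rewrite inE.
have -> : \sum_(r : {perm 'I_m}) \sum_(c : {set 'I_m}) coin_weight x c *
    exp_gain (seeded_alg (tau m) r c) [::]
      [seq (ends ((r * q)%g t), w ((r * q)%g t)) | t <- enum 'I_m]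
  = \sum_(r : {perm 'I_m}) \sum_(c : {set 'I_m}) coin_weight x c *
    exp_gain (seeded_alg (tau m) r c) [::] [seq v (r t) | t <- enum 'I_m].
  apply: eq_bigr => r _; apply: eq_bigr => c _.
  by congr (_ * exp_gain _ _ _); apply: eq_map => t; rewrite permM.
apply: (seeded_alg_weight (g := g)) => //; first exact: ltnW.
- by move=> e; exact: nl.
- by move=> e; exact: w0.
- move=> k kg /(has_cycle_map (f := q) (S' := fun=> True) (ends' := ends)) H.
  by apply: (girth k kg); apply: H => //; exact: perm_inj.
- move=> k /(has_cycle_map (f := q) (S' := fun e => e \in S) (ends' := ends)) H.
  apply: (acS k); apply: H => //; first exact: perm_inj.
  by move=> e; rewrite inE.
Qed.
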